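(* Let $n\ge 2$, let $H\le\mathbb{Z}_n$ be a subgroup of size $t\ge 3$, and let $A\subseteq\mathbb{Z}_n$. Choose a coset $C=a+H$ of $H$ maximizing $x:=|A\cap C|$, set $r:=r_H(A)-1$, and define $$\alpha^\star:=\max\{0,\ \min\{p(t),\ 2x-3\}\}.$$ Suppose $|A\widehat{+}A|\le t+s$ for some integer $s\ge 0$. Then, if $x>0$ (equivalently, $A\neq\varnothing$), $$r\le \frac{t+s-\alpha^\star}{x}.$$ In particular, if $2x-3\le p(t)$ and $3x>t+s+3$, then $r=0$ and hence $A\subseteq C$.
   Context: $\mathbb{Z}_n$ denotes the additive cyclic group of integers modulo $n$. For $A\subseteq\mathbb{Z}_n$ the restricted self-sumset is $A\widehat{+}A=\{a+a' : a,a'\in A,\ a\ne a'\}\subseteq\mathbb{Z}_n$ (so it is empty, of size $0$, when $|A|\le 1$). For a subgroup $H\le\mathbb{Z}_n$, $r_H(A)$ denotes the number of $H$-cosets that meet $A$, i.e. the size of the image of $A$ in $\mathbb{Z}_n/H$; thus $r=r_H(A)-1$ (an integer) is, for nonempty $A$, the number of $H$-cosets other than $C$ that meet $A$. For an integer $t\ge 2$, $p(t)$ is the least prime divisor of $t$. The quotient $(t+s-\alpha^\star)/x$ is a rational number. *)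

(* Defs.v *)
From HB Require Import structures.
From mathcomp Require Import all_boot all_order all_algebra all_fingroup.

Set Implicit Arguments.
Unset Strict Implicit.
Unset Printing Implicit Defensive.

Import Order.TTheory GRing.Theory Num.Theory.

Local Open Scope ring_scope.

(* The finGroupType structure of 'Z_n is the additive one, so that
   {group 'Z_n} is the type of subgroups of (Z/n, +), and the left coset
   (a *: H)%g is the set a + H.  Recall that 'Z_n is Z/n only for 1 < n. *)

Definition restricted_sumset (n : nat) (A : {set 'Z_n}) : {set 'Z_n} :=
  [set a + a' | a in A, a' in A & a != a'].

Definition num_cosets (n : nat) (H : {group 'Z_n}) (A : {set 'Z_n}) : nat :=
  #|lcosets H A|.

(* Computed in int: the subtraction must not be truncated. *)
Definition alpha_star (t x : nat) : int :=
  Num.max 0 (Num.min (pdiv t)%:Z (2 * x%:Z - 3)).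

(* Main.v *)
(* Let k = #|A :&: C|.  Inside C + C the Erdos-Heilbronn theorem for the cyclic
   group H gives min(p(t), 2k - 3) restricted sums, and each of the r other
   cosets D meeting A gives at least k further sums in the coset C + D.

   Erdos-Heilbronn is proved for every finite abelian group, in the form
   |A^A| >= 2|A| - 3 whenever 2|A| - 3 is at most the least prime divisor p of
   the order.  In prime order it is the polynomial method: there are weights on
   the grid A x (A minus a point) whose sum against (x - y) prod_c (x + y - c)
   extracts a top-degree coefficient, which is a difference of two binomials
   prime to p, whereas this polynomial vanishes on the grid if all restricted
   sums are among the c.  In general, take a subgroup K of prime order
   and the fibres A_b of A over its image B in G/K, with A_1 a largest one.  If
   |A_1| = 1 then A embeds in G/K, and one inducts.  Otherwise A_1^A_1 and the
   A_1 + A_b, bounded by prime order and by Cauchy-Davenport, fall short by at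
   most |B| - 1 - u, with u the number of singleton fibres, and the at least
   |B| - 1 - u further cosets in B + B, other than doubles of singleton
   fibres, make up for it. *)

Require Import Defs.
From HB Require Import structures.
From mathcomp Require Import all_boot all_order all_algebra all_fingroup all_solvable.
From mathcomp Require Import zify ring.

Set Implicit Arguments.
Unset Strict Implicit.
Unset Printing Implicit Defensive.

Import Order.TTheory GRing.Theory Num.Theory.

Local Open Scope ring_scope.

(** * Coefficient extraction on a grid *)

(* Over a set of k points, this functional reads off the coefficient of X^(k-1)
   of a polynomial of degree less than k. *)
Lemma dual_weights (F : fieldType) (s : seq F) : uniq s ->
  exists w : F -> F, forall i, (i < size s)%N ->
    \sum_(a <- s) w a * a ^+ i = (i.+1 == size s)%:R.
Proof.
elim: s => [|b s IHs] /=; first by exists (fun=> 0).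
case/andP=> bNs /IHs[w wP].
(* With these weights, a multiple of [X - b] is sent to the old functional of its cofactor; the
   weight at [b] then corrects the moment of order 0. *)
pose v a := w a / (a - b).
pose w' a := if a == b then (size s == 0%N)%:R - \sum_(c <- s) v c else v a.
have w's (f : F -> F) : \sum_(a <- s) w' a * f a = \sum_(a <- s) v a * f a.
  apply: eq_big_seq => a sa; rewrite /w'; case: eqVneq => // ab.
  by rewrite -ab sa in bNs.
have w'0 : \sum_(a <- b :: s) w' a * a ^+ 0%N = (size s == 0%N)%:R.
  rewrite big_cons (w's (fun a => a ^+ 0%N)) /w' eqxx expr0 mulr1.
  under [X in _ + X]eq_bigr => a _ do rewrite expr0 mulr1.
  by rewrite subrK.
have w'S i : \sum_(a <- b :: s) w' a * a ^+ i.+1 =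
    \sum_(a <- s) w a * a ^+ i + b * \sum_(a <- b :: s) w' a * a ^+ i.
  rewrite !big_cons (w's (fun a => a ^+ i.+1)) (w's (fun a => a ^+ i)).
  rewrite mulrDr addrCA; congr (_ + _); first by rewrite exprS; ring.
  rewrite mulr_sumr -big_split; apply: eq_big_seq => a sa.
  have ab : a - b != 0 by rewrite subr_eq0; apply: contraNneq bNs => <-.
  by rewrite /v exprS /=; field.
exists w'; elim=> [|i IHi] lt_i; first by rewrite w'0 eqSS eq_sym.
rewrite w'S wP // IHi 1?ltnW // !eqSS (_ : (i == size s) = false); last by lia.
by rewrite mulr0 addr0.
Qed.

Section GridFunctional.

Variables (F : fieldType) (s1 s2 : seq F) (w1 w2 : F -> F) (d1 d2 : nat).
Hypothesis w1P : forall i, (i <= d1)%N -> \sum_(a <- s1) w1 a * a ^+ i = (i == d1)%:R.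
Hypothesis w2P : forall i, (i <= d2)%N -> \sum_(a <- s2) w2 a * a ^+ i = (i == d2)%:R.

(** The product functional at X^i Y^j prod_c (X + Y - c); free exponents keep the family closed
    under expanding one factor. *)
Let T (i j : nat) (cs : seq F) := \sum_(a <- s1) \sum_(b <- s2)
  w1 a * w2 b * (a ^+ i * b ^+ j * \prod_(c <- cs) (a + b - c)).

Lemma grid_nil i j :
  T i j [::] = (\sum_(a <- s1) w1 a * a ^+ i) * \sum_(b <- s2) w2 b * b ^+ j.
Proof.
rewrite mulr_suml; apply: eq_bigr => a _; rewrite mulr_sumr.
by apply: eq_bigr => b _; rewrite big_nil; ring.
Qed.

Lemma grid_cons i j c cs :
  T i j (c :: cs) = T i.+1 j cs + T i j.+1 cs - c * T i j cs.
Proof.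
rewrite /T mulr_sumr -sumrN -!big_split; apply: eq_bigr => a _ /=.
rewrite mulr_sumr -sumrN -!big_split; apply: eq_bigr => b _ /=.
by rewrite big_cons !exprS; ring.
Qed.

(** A monomial of degree below [d1 + d2] has X-exponent below [d1] or Y-exponent below [d2], so one
    of its two moments vanishes. *)
Lemma grid_lt i j cs : (i + j + size cs < d1 + d2)%N -> T i j cs = 0.
Proof.
elim: cs i j => [|c cs IHcs] i j /= lt_d.
  rewrite grid_nil; have [lt_i|le_d1] := ltnP i d1.
    by rewrite w1P 1?ltnW // ltn_eqF // mul0r.
  by rewrite w2P ?ltn_eqF ?mulr0 //; lia.
by rewrite grid_cons !IHcs ?mulr0 ?addr0 ?subr0 //; lia.
Qed.

(** Only the leading form X^i Y^j (X + Y)^m counts, with m = [size cs]; its coefficient of X^d1 Y^d2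
    is this binomial. The factor [i <= d1] guards the truncated subtraction. *)
Lemma grid_eq i j cs : (i + j + size cs = d1 + d2)%N ->
  T i j cs = ((i <= d1) * 'C(size cs, d1 - i))%:R.
Proof.
elim: cs i j => [|c cs IHcs] i j /= eq_d.
  rewrite grid_nil; have [lt_i|lt_d1|eq_i] := ltngtP i d1.
  - rewrite w1P 1?ltnW // ltn_eqF // mul0r.
    by rewrite bin_small ?subn_gt0.
  - by rewrite w2P ?ltn_eqF ?mulr0 //; lia.
  - have ->: j = d2 by lia.
    by rewrite w1P ?w2P ?eq_i // !eqxx subnn mulr1.
have IHi : (i.+1 + j + size cs = d1 + d2)%N by lia.
have IHj : (i + j.+1 + size cs = d1 + d2)%N by lia.
rewrite grid_cons (IHcs _ _ IHi) (IHcs _ _ IHj) grid_lt; last by lia.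
rewrite mulr0 subr0 -natrD; congr _%:R.
have [lt_i|lt_d1|->] := ltngtP i d1; rewrite ?mul0n //; last by rewrite subnn !bin0.
by rewrite -[(d1 - i)%N]prednK ?subn_gt0 // subnS binS !mul1n addnC.
Qed.

End GridFunctional.

(** The two sides are the functional at X prod_c (X + Y - c) and at Y prod_c (X + Y - c), which
    agree on the grid: where x and y differ, some factor is zero. *)
Lemma restricted_sums_binomial (F : fieldType) (s1 s2 cs : seq F) (d1 d2 : nat) :
    uniq s1 -> uniq s2 -> size s1 = d1.+2 -> size s2 = d2.+1 ->
    size cs = (d1 + d2)%N ->
    (forall a b, a \in s1 -> b \in s2 -> a != b -> a + b \in cs) ->
  'C(d1 + d2, d1)%:R = 'C(d1 + d2, d1.+1)%:R :> F.
Proof.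
move=> /dual_weights[w1 w1P] /dual_weights[w2 w2P] sz1 sz2 szc sums.
rewrite sz1 in w1P; rewrite sz2 in w2P.
have h1 i : (i <= d1.+1)%N -> \sum_(a <- s1) w1 a * a ^+ i = (i == d1.+1)%:R.
  by move=> le_i; rewrite w1P.
have h2 i : (i <= d2)%N -> \sum_(a <- s2) w2 a * a ^+ i = (i == d2)%:R.
  by move=> le_i; rewrite w2P.
have := grid_eq h1 h2 (i := 1) (j := 0) (cs := cs).
have := grid_eq h1 h2 (i := 0) (j := 1) (cs := cs).
rewrite szc !mul1n subn0 subSS subn0 => <-; last by lia.
move=> <-; last by lia.
apply/eqP; rewrite -subr_eq0 -sumrB big_seq big1 // => a sa.
rewrite -sumrB big_seq big1 // => b sb.
rewrite !expr0 !expr1 mulr1 mul1r -mulrBr -mulrBl.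
have [->|neq_ab] := eqVneq a b; first by rewrite subrr mul0r mulr0.
by rewrite (big_rem (a + b)) ?sums //= subrr mul0r !mulr0.
Qed.

(** * Restricted products and the case of prime order *)

Section RestrictedProduct.

Local Open Scope group_scope.

(** Multiplicative notation gives access to quotient groups; on ['Z_n] this is convertible with
    [restricted_sumset]. *)
Definition restricted_product (gT : finGroupType) (A : {set gT}) : {set gT} :=
  [set x * y | x in A, y in A & x != y].

Lemma restricted_productP (gT : finGroupType) (A : {set gT}) (z : gT) :
  reflect (exists x y, [/\ x \in A, y \in A, x != y & z = x * y])
          (z \in restricted_product A).
Proof.
apply: (iffP imset2P) => [[x y Ax]|[x [y [Ax Ay xy ->]]]].
  by rewrite inE => /andP[Ay xy ->]; exists x, y.
by exists x y => //; rewrite inE Ay.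
Qed.

Lemma restricted_productS (gT : finGroupType) (A B : {set gT}) :
  A \subset B -> restricted_product A \subset restricted_product B.
Proof.
move/subsetP=> sAB; apply/subsetP=> z /restricted_productP[x [y [Ax Ay xy ->]]].
by apply/restricted_productP; exists x, y; split; auto.
Qed.

Lemma restricted_product_prime (gT : finGroupType) (G : {group gT}) (A : {set gT}) :
    prime #|G| -> A \subset G -> (2 * #|A| <= #|G| + 3)%N ->
  (2 * #|A| <= #|restricted_product A| + 3)%N.
Proof.
move=> p_pr /subsetP sAG leA; rewrite leqNgt; apply/negP=> ltA.
have /cyclicP[g defG] := prime_cyclic p_pr; set p := #|G| in p_pr leA.
have og : #[g] = p by rewrite /p defG.
(* [f] turns addition in the field ['F_p] into the product of [G]. *)
pose f (i : 'F_p) := g ^+ i.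
have f_inj : injective f.
  move=> i j /eqP; rewrite eq_expg_mod_order og => /eqP ij; apply: val_inj.
  have ltp (k : 'F_p) : (k < p)%N by rewrite -[X in (_ < X)%N](Fp_cast p_pr).
  by rewrite /= -(modn_small (ltp i)) -(modn_small (ltp j)).
have fD i j : f (i + j)%R = f i * f j.
  by rewrite /f expg_mod ?expgD // (Fp_cast p_pr) -og expg_order.
pose preim (S : {set gT}) := [set i | f i \in S].
have card_preim (S : {set gT}) : (#|preim S| <= #|S|)%N.
  rewrite -(card_imset _ f_inj); apply/subset_leq_card/subsetP=> _ /imsetP[i + ->].
  by rewrite inE.
have cardA : #|preim A| = #|A|.
  apply/eqP; rewrite eqn_leq card_preim -(card_imset (preim A) f_inj).
  apply/subset_leq_card/subsetP=> a Aa.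
  have /cyclePmin[i lt_i def_a] : a \in <[g]> by rewrite -defG sAG.
  have def_f : f (i%:R)%R = a by rewrite /f val_Fp_nat // -og modn_small.
  by apply/imsetP; exists (i%:R)%R; rewrite // inE def_f.
have [h defh] : exists h, #|A| = h.+2 by exists (#|A| - 2)%N; lia.
set C := preim (restricted_product A).
have leC : (#|C| <= h + h)%N by have := card_preim (restricted_product A); rewrite -/C; lia.
pose s1 := enum (preim A); pose s2 := behead s1.
have sz1 : size s1 = h.+2 by rewrite -cardE cardA.
have sz2 : size s2 = h.+1 by rewrite size_behead sz1.
have us1 : uniq s1 by exact: enum_uniq.
have s21 : {subset s2 <= s1} by move=> i; apply: mem_behead.
have us2 : uniq s2 by rewrite /s2 -drop1 drop_uniq.
pose cs := enum C ++ nseq (h + h - #|C|) 0%R.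
have szc : size cs = (h + h)%N by rewrite size_cat size_nseq -cardE subnKC.
have sums a b : a \in s1 -> b \in s2 -> a != b -> (a + b)%R \in cs.
  move=> sa /s21 sb ab; rewrite mem_cat mem_enum inE fD.
  rewrite !mem_enum !inE in sa sb; apply/orP; left.
  by apply/restricted_productP; exists (f a), (f b); rewrite (inj_eq f_inj).
have := restricted_sums_binomial us1 us2 sz1 sz2 szc sums.
(* Since (h+1) C(2h, h+1) = h C(2h, h), this leaves C(2h, h) = 0 modulo p, impossible because 2h <
   p. *)
move/(congr1 (fun u => (h.+1)%:R * u)%R); rewrite -!natrM mul_bin_left addnK.
move/eqP; rewrite -subr_eq0 -natrB ?leq_mul2r ?leqnSn ?orbT //.
rewrite -mulnBl subSnn mul1n -(dvdn_pcharf (pchar_Fp p_pr)) => dvd_bin.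
have : (p %| (h + h)`!)%N.
  by rewrite -(@bin_fact (h + h) h) ?leq_addr // dvdn_mulr.
have: (h + h < p)%N by lia.
elim: (h + h)%N => [|m IHm] lt_m; first by rewrite dvdn1 => /eqP p1; rewrite p1 in p_pr.
by rewrite factS Euclid_dvdM // gtnNdvd //=; apply: IHm; exact: ltnW.
Qed.

Lemma restricted_product_lcoset (gT : finGroupType) (G : {group gT}) (g : gT)
    (A : {set gT}) : abelian G -> g \in G -> A \subset G ->
  #|restricted_product (g *: A)| = #|restricted_product A|.
Proof.
move=> cGG Gg /subsetP sAG.
have gC x : x \in A -> x * g = g * x by move=> /sAG Gx; apply: (centsP cGG _ Gx _ Gg).
rewrite -(card_lcoset (restricted_product A) (g * g)); apply: eq_card => z.
apply/idP/lcosetP.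
  case/restricted_productP=> _ [_ [/lcosetP[x Ax ->] /lcosetP[y Ay ->] xy ->]].
  exists (x * y); last by rewrite -!mulgA (mulgA x) gC // !mulgA.
  by apply/restricted_productP; exists x, y; rewrite (inj_eq (mulgI g)) in xy.
case=> _ /restricted_productP[x [y [Ax Ay xy ->]] ->].
apply/restricted_productP; exists (g * x), (g * y).
rewrite !mem_lcoset !mulKg (inj_eq (mulgI g)); split=> //.
by rewrite -!mulgA (mulgA x) gC // !mulgA.
Qed.

(** * Cauchy-Davenport in abelian groups *)

(* The Dyson transform replaces (A, B) by (A :|: c *: B, B :&: c^-1 *: A);
   when no such step shrinks B, the set A is a union of cosets of a
   nontrivial cyclic group. *)
Lemma cauchy_davenport_abelian (gT : finGroupType) (G : {group gT}) (p : nat)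
    (A B : {set gT}) :
    abelian G -> (forall q, prime q -> q %| #|G| -> p <= q)%N ->
    A \subset G -> B \subset G -> A != set0 -> B != set0 ->
  (#|A| + #|B| <= p.+1)%N -> (#|A| + #|B| <= #|(A * B)%g|.+1)%N.
Proof.
move=> cGG p_min; have [m] := ubnP #|B|.
elim: m A B => // m IHm A B ltB sAG sBG ntA ntB le_p.
have [a0 Aa0] := set0Pn _ ntA; have [b0 Bb0] := set0Pn _ ntB.
have cG x y : x \in G -> y \in G -> x * y = y * x by move=> Gx Gy; apply: (centsP cGG _ Gx _ Gy).
have [stable|] := boolP [forall a in A, forall b in B, a * b0^-1 * b \in A].
  have [lt1B|leB1] := ltnP 1 #|B|; last first.
    apply: leq_trans (leq_add (leqnn _) leB1) _; rewrite addn1 ltnS.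
    by rewrite -(card_rcoset A b0); apply/subset_leq_card/mulgS; rewrite sub1set.
  have [b Bb bb0] : exists2 b, b \in B & b != b0.
    have /set0Pn[b] : B :\ b0 != set0 by rewrite -card_gt0; move: lt1B; rewrite (cardsD1 b0) Bb0.
    by rewrite !inE => /andP[? ?]; exists b.
  (* Stability under [x] puts a coset of [<[x]>], hence at least [p] elements, inside [A]: too many
     when [B] has two elements. *)
  pose x := b0^-1 * b.
  have Ax i : a0 * x ^+ i \in A.
    elim: i => [|i IHi]; first by rewrite mulg1.
    by rewrite expgSr mulgA /x mulgA; exact: (forall_inP (forall_inP stable _ IHi)).
  have sxA : a0 *: <[x]> \subset A.
    by apply/subsetP=> _ /lcosetP[_ /cycleP[i ->] ->].
  have ntx : x != 1.
    by apply: contra bb0 => /eqP; rewrite /x => /(canRL (mulKVg _)) ->; rewrite mulg1.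
  have Gx : x \in G by rewrite groupM ?groupV ?(subsetP sBG).
  have le_px : (p <= #[x])%N.
    have gt1 : (1 < #[x])%N by rewrite order_gt1.
    apply: leq_trans (p_min (pdiv #[x]) (pdiv_prime gt1) _) (pdiv_leq (ltnW gt1)).
    exact: dvdn_trans (pdiv_dvd _) (order_dvdG Gx).
  have le_pA : (p <= #|A|)%N.
    by rewrite (leq_trans le_px) // /order -(card_lcoset <[x]> a0) subset_leq_card.
  by have := leq_trans (leq_add le_pA lt1B) le_p; rewrite addn2 ltnn.
case/forall_inPn=> a Aa /forall_inPn[b Bb abNA].
(* This [c] sends [b0] into [A] and [b] outside it, so [B'] keeps [b0] and loses [b]. *)
pose c := a * b0^-1; have [Ga Gb0] := (subsetP sAG _ Aa, subsetP sBG _ Bb0).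
have Gc : c \in G by rewrite groupM ?groupV.
pose A' := A :|: c *: B; pose B' := B :&: c^-1 *: A.
have cB' : c *: B' = A :&: c *: B.
  apply/setP=> z; rewrite mem_lcoset !inE !mem_lcoset invgK mulKVg; exact: andbC.
have cardAB' : (#|A'| + #|B'| = #|A| + #|B|)%N.
  by rewrite -(card_lcoset B' c) cB' cardsUI card_lcoset.
have Bb0' : b0 \in B'.
  by rewrite inE Bb0 mem_lcoset invgK /c mulgKV.
have ltB' : (#|B'| < #|B|)%N.
  apply/proper_card/properP; split; first exact: subsetIl.
  by exists b => //; rewrite inE Bb mem_lcoset invgK.
have sA'G : A' \subset G.
  rewrite subUset sAG; apply/subsetP=> _ /lcosetP[y By ->].
  by rewrite groupM // (subsetP sBG).
have sB'G : B' \subset G by rewrite subIset ?sBG.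
have ntA' : A' != set0 by apply/set0Pn; exists a; rewrite inE Aa.
have ntB' : B' != set0 by apply/set0Pn; exists b0.
rewrite -cardAB' in le_p *.
apply: leq_trans (IHm _ _ (leq_trans ltB' _) sA'G sB'G ntA' ntB' le_p) _ => //.
rewrite ltnS; apply/subset_leq_card/subsetP=> _ /mulsgP[u v /setUP[Au|Bu] /setIP[Bv Av] ->].
  exact: mem_mulg.
case/lcosetP: Bu => y By ->; case/lcosetP: Av => w Aw ->.
have [Gy Gw] := (subsetP sBG _ By, subsetP sAG _ Aw).
rewrite (cG c) // mulgA mulgK cG //; exact: mem_mulg.
Qed.

(** * Fibres over a quotient *)

Definition fiber (gT : finGroupType) (K A : {set gT}) (c : coset_of K) : {set gT} :=
  [set x in A | coset K x == c].

#[global] Arguments fiber {gT} K A c.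

Section Fibers.

Variables (gT : finGroupType) (G K : {group gT}) (A : {set gT}).
Hypotheses (cGG : abelian G) (sKG : K \subset G) (sAG : A \subset G).

Let nKG : G \subset 'N(K) := sub_abelian_norm cGG sKG.
Let B := coset K @: A.

Let AG x : x \in A -> x \in G. Proof. exact: (subsetP sAG). Qed.

Lemma coset_abelianM x y : x \in A -> y \in A -> coset K (x * y) = coset K x * coset K y.
Proof. by move=> /AG Gx /AG Gy; rewrite morphM ?(subsetP nKG). Qed.

Lemma sum_card_fibers (S : {set gT}) (D : {set coset_of K}) :
  (\sum_(c in D) #|fiber K S c| <= #|S|)%N.
Proof.
rewrite -[leqRHS]sum1_card (partition_big (coset K) predT) //= [leqLHS]big_mkcond /=.
apply: leq_sum => c _; rewrite -sum1_card; case: (c \in D) => //.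
by rewrite leq_eqVlt; apply/orP; left; apply/eqP/eq_bigl => x; rewrite inE.
Qed.

Lemma sum_card_fibers_im : (\sum_(c in B) #|fiber K A c| = #|A|)%N.
Proof.
rewrite -[RHS]sum1_card (partition_big (coset K) (mem B)) /=; last exact: imset_f.
apply: eq_bigr => c _; rewrite -sum1_card.
by apply: eq_bigl => x; rewrite inE.
Qed.

Lemma restricted_product_fiber b :
  restricted_product (fiber K A b) \subset fiber K (restricted_product A) (b * b).
Proof.
apply/subsetP=> _ /restricted_productP[x [y [+ + xy ->]]]; rewrite !inE.
case/andP=> Ax /eqP bx /andP[Ay /eqP bY]; rewrite coset_abelianM // bx bY eqxx andbT.
by apply/restricted_productP; exists x, y.
Qed.

(** Factors from different fibres are automatically distinct, so the whole product set survives. *)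
Lemma mul_fiber b c : b != c ->
  fiber K A b * fiber K A c \subset fiber K (restricted_product A) (b * c).
Proof.
move=> bc; apply/subsetP=> _ /mulsgP[x y + + ->]; rewrite !inE.
case/andP=> Ax /eqP bx /andP[Ay /eqP cy]; rewrite coset_abelianM // bx cy eqxx andbT.
apply/restricted_productP; exists x, y; split=> //.
by apply: contraNneq bc => xy; rewrite -bx -cy xy.
Qed.

Lemma fiber_neq0 b : b \in B -> fiber K A b != set0.
Proof. by case/imsetP=> x Ax ->; apply/set0Pn; exists x; rewrite inE Ax eqxx. Qed.

Lemma restricted_product_im_coset :
  restricted_product B \subset coset K @: restricted_product A.
Proof.
apply/subsetP=> _ /restricted_productP[_ [_ [/imsetP[x Ax ->] /imsetP[y Ay ->] xy ->]]].
rewrite -coset_abelianM //; apply/imset_f/restricted_productP; exists x, y.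
by split=> //; apply: contraNneq xy => ->.
Qed.

Lemma im_coset_sub : B \subset G / K.
Proof. by apply/subsetP=> _ /imsetP[x /AG Gx ->]; apply/mem_quotient. Qed.

Lemma fiber_sub b : fiber K A b \subset G.
Proof. by apply/subsetP=> x; rewrite inE => /andP[/AG]. Qed.

Lemma fiber_translate b : b \in B -> exists g (A0 : {set gT}),
  [/\ g \in G, A0 \subset K & fiber K A b = g *: A0].
Proof.
case/imsetP=> g Ag ->; exists g, (g^-1 *: fiber K A (coset K g)).
split; [exact: AG | | by rewrite -lcosetM mulgV lcoset1].
apply/subsetP=> _ /lcosetP[x + ->]; rewrite inE => /andP[Ax /eqP eq_xg].
have [Nx Ng] : x \in 'N(K) /\ g \in 'N(K) by rewrite !(subsetP nKG) ?AG.
by apply: coset_idr; rewrite ?groupM ?groupV // morphM ?groupV // morphV //= eq_xg mulVg.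
Qed.

End Fibers.

(** * Counting when a largest fibre has several elements *)

Section FiberBound.

Variables (gT : finGroupType) (G K : {group gT}) (p : nat) (A : {set gT}).
Hypotheses (cGG : abelian G) (sKG : K \subset G) (sAG : A \subset G).
Hypothesis p_min : (forall q, prime q -> q %| #|G| -> p <= q)%N.
Hypothesis prK : prime #|K|.
Hypothesis leA : (2 * #|A| <= p + 3)%N.

Let B := coset K @: A.
Let k b := #|fiber K A b|.
Let N c := #|fiber K (restricted_product A) c|.

Variable b1 : coset_of K.
Hypotheses (Bb1 : b1 \in B) (b1_max : forall b, b \in B -> (k b <= k b1)%N).
Hypothesis k1_gt1 : (1 < k b1)%N.

Let sumk : (\sum_(b in B) k b = #|A|)%N := sum_card_fibers_im K A.

Let k_gt0 b : b \in B -> (0 < k b)%N.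
Proof. by move=> Bb; rewrite card_gt0 fiber_neq0. Qed.

(** Strictness comes from the fibre over [b1]; it yields 2|B| <= p + 1, as Cauchy-Davenport for
    [B * B] requires. *)
Let lt_BA : (#|B| < #|A|)%N.
Proof.
rewrite -sumk (bigD1 b1) //= (cardsD1 b1) Bb1 -addSn leq_add //.
rewrite -sum1_card; under eq_bigl do rewrite !inE andbC.
by apply: leq_sum => b /andP[/k_gt0].
Qed.

Let diagonal : (2 * k b1 <= N (b1 * b1) + 3)%N.
Proof.
have leN : (#|restricted_product (fiber K A b1)| <= N (b1 * b1))%N.
  exact/subset_leq_card/(restricted_product_fiber cGG sKG sAG b1).
have [g [A0 [Gg sA0K defA1]]] := fiber_translate cGG sKG sAG Bb1.
have sA0G := subset_trans sA0K sKG.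
move: leN; rewrite /k defA1 (restricted_product_lcoset cGG) // card_lcoset => leN.
apply: leq_trans (leq_add leN (leqnn 3)).
apply: (restricted_product_prime prK) => //.
rewrite -(card_lcoset A0 g) -defA1.
have leKA : (k b1 <= #|A|)%N by rewrite -sumk (bigD1 b1) //= leq_addr.
have := p_min prK (cardSg sKG); rewrite -/(k b1); lia.
Qed.

Let off_diagonal b : b \in B :\ b1 -> (k b1 + k b <= N (b1 * b) + 1)%N.
Proof.
rewrite 2!inE => /andP[neq_b Bb].
have leN : (#|(fiber K A b1 * fiber K A b)%g| <= N (b1 * b))%N.
  by apply/subset_leq_card/(mul_fiber cGG sKG sAG); rewrite eq_sym.
have lek : (k b1 + k b <= #|A|)%N.
  by rewrite -sumk (bigD1 b1) //= leq_add2l (bigD1 b) ?Bb ?neq_b //= leq_addr.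
apply: leq_trans (leq_add leN (leqnn 1)); rewrite addn1.
apply: (cauchy_davenport_abelian cGG p_min); rewrite ?fiber_sub ?fiber_neq0 //.
rewrite -/(k b1) -/(k b); lia.
Qed.

(** [E] consists of cosets outside [b1 *: B] sure to contain a restricted product; [D2] is removed
    because a singleton fibre has no two distinct elements to multiply. *)
Let D := [set b in B | (k b <= 1)%N].
Let D2 := [set b * b | b in D].
Let E := (B * B) :\: (b1 *: B) :\: D2.

Let extra_gt0 c : c \in E -> (0 < N c)%N.
Proof.
rewrite in_setD => /andP[cND]; rewrite in_setD => /andP[_ /mulsgP[b d Bb Bd def_c]].
rewrite card_gt0; have [eq_bd|neq_bd] := eqVneq b d; last first.
  have [[x xb] [y yd]] := (set0Pn _ (fiber_neq0 Bb), set0Pn _ (fiber_neq0 Bd)).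
  apply/set0Pn; exists (x * y); rewrite def_c.
  by apply: (subsetP (mul_fiber cGG sKG sAG neq_bd)); rewrite mem_mulg.
have /card_gt1P[x [y [xb yb xy]]] : (1 < k b)%N.
  rewrite ltnNge; apply: contra cND => le_kb; apply/imsetP; exists b.
    by rewrite inE Bb.
  by rewrite def_c eq_bd.
apply/set0Pn; exists (x * y); rewrite def_c -eq_bd.
apply: (subsetP (restricted_product_fiber cGG sKG sAG b)).
by apply/restricted_productP; exists x, y.
Qed.

(** Cauchy-Davenport gives 2|B| - 1 elements of [B * B]; at most |B| lie in [b1 *: B] and at most
    |D| in [D2]. *)
Let card_extra : (#|B| <= #|E| + #|D| + 1)%N.
Proof.
have p_minB q : prime q -> (q %| #|G / K| -> p <= q)%N.
  by move=> pr_q dv_q; apply: p_min => //; apply: dvdn_trans dv_q (dvdn_quotient _ _).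
have sBG := im_coset_sub K sAG.
have ntB : B != set0 by apply/set0Pn; exists b1.
have le2B : (#|B| + #|B| <= p.+1)%N by lia.
have leBB : (#|B| + #|B| <= #|(B * B)%g|.+1)%N.
  exact: (cauchy_davenport_abelian (quotient_abelian K cGG) p_minB sBG sBG ntB ntB le2B).
have leD : (#|D2| <= #|D|)%N by apply: leq_imset_card.
have leU : (#|(B * B)%g| <= #|E| + #|D| + #|B|)%N.
  have leI1 : (#|(B * B :&: b1 *: B)%g| <= #|B|)%N.
    by rewrite -(card_lcoset B b1) subset_leq_card ?subsetIr.
  have leI2 : (#|((B * B :\: b1 *: B) :&: D2)%g| <= #|D|)%N.
    exact: leq_trans (subset_leq_card (subsetIr _ _)) leD.
  rewrite -(cardsID (b1 *: B) (B * B)) -(cardsID D2 (B * B :\: b1 *: B)).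
  by rewrite addnC leq_add // addnC leq_add.
have := leq_trans leBB (leU : (_.+1 <= _.+1)%N).
by rewrite -addSn leq_add2r -addn1.
Qed.

(** Termwise: a singleton fibre falls short of [k b1] by at least 1. *)
Let sum_bound : (#|A| + #|D| <= #|B| * k b1)%N.
Proof.
have ->: #|D| = (\sum_(b in B) (k b <= 1)%N)%N.
  rewrite -sum1_card big_mkcond [RHS]big_mkcond; apply: eq_bigr => b _.
  by rewrite inE; case: (b \in B) => //; case: leqP.
rewrite -sumk -big_split -sum_nat_const; apply: leq_sum => b Bb /=.
by case: (leqP (k b) 1) (b1_max Bb); lia.
Qed.

(** With k1 = [k b1], the contributions 2 k1 - 3 of [b1 * b1], k1 + k b - 1 of each other [b1 * b],
    and |B| - 1 - |D| of [E] add up to |A| + |B| k1 - |D| - 3, which is at least 2|A| - 3 by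
    [sum_bound]. *)
Lemma restricted_product_fiber_bound : (2 * #|A| <= #|restricted_product A| + 3)%N.
Proof.
have lcosetN : (\sum_(c in b1 *: B) N c = \sum_(b in B) N (b1 * b))%N.
  by rewrite -lcosetE /lcoset big_imset //= => b d _ _ /mulgI.
have sumN : (\sum_(b in B) N (b1 * b) + #|E| <= #|restricted_product A|)%N.
  apply: leq_trans (sum_card_fibers (restricted_product A) (b1 *: B :|: E)).
  rewrite [leqRHS](eq_bigl (mem [predU b1 *: B & E])) => [|c];
    last by rewrite in_setU.
  rewrite bigU /=; last first.
    rewrite -setI_eq0; apply/eqP/setP=> c; rewrite !inE.
    by case: (c \in b1 *: B); rewrite ?andbF.
  by rewrite lcosetN leq_add2l -sum1_card; apply: leq_sum => c /extra_gt0.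
have := sumN; rewrite (big_setD1 b1) //= => {}sumN.
have off : (\sum_(b in B :\ b1) (k b1 + k b) <= \sum_(b in B :\ b1) N (b1 * b) + #|B :\ b1|)%N.
  by rewrite -[#|B :\ b1|]sum1_card -big_split; apply: leq_sum.
move: off; rewrite big_split sum_nat_const /=.
have := sumk; rewrite (big_setD1 b1) //=.
have := cardsD1 b1 B; rewrite Bb1 add1n.
have := sum_bound; have := card_extra; have := diagonal; move: sumN.
move: (\sum_(b in B :\ b1) N _)%N (\sum_(b in B :\ b1) k _)%N (N _) (k b1).
move: #|restricted_product A| #|A| #|B :\ b1| #|B| #|E| #|D|.
move=> R a l' l e d S S' N1 k1 h1 h2 h3 h4 hl h6 h7.
move: h4; rewrite hl mulSn => h4.
lia.
Qed.

End FiberBound.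

(** * Erdos-Heilbronn in abelian groups *)

Lemma restricted_product_abelian (gT : finGroupType) (G : {group gT}) (p : nat)
    (A : {set gT}) :
    abelian G -> (forall q, prime q -> q %| #|G| -> p <= q)%N ->
    A \subset G -> (2 * #|A| <= p + 3)%N ->
  (2 * #|A| <= #|restricted_product A| + 3)%N.
Proof.
have [m] := ubnP #|G|; elim: m => // m IHm in gT G A *.
move=> ltG cGG p_min sAG leA; have [|A_gt1] := leqP #|A| 1; first lia.
have G_gt1 : (1 < #|G|)%N := leq_trans A_gt1 (subset_leq_card sAG).
have [x Gx ox] := Cauchy (pdiv_prime G_gt1) (pdiv_dvd #|G|).
pose K := <[x]>%G.
have prK : prime #|K| by rewrite [#|K|]ox pdiv_prime.
have sKG : K \subset G by rewrite cycle_subG.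
have /set0Pn[a Aa] : A != set0 by rewrite -card_gt0 ltnW.
pose b0 := coset K a; have Bb0 : b0 \in coset K @: A by exact: imset_f.
case: (arg_maxnP (fun b => #|fiber K A b|) Bb0) => b1 Bb1 b1_max.
have [k1_le1|] := leqP #|fiber K A b1| 1; last first.
  by apply: (restricted_product_fiber_bound cGG sKG sAG p_min).
(* All fibres are singletons, so [A] embeds in [G / K], a smaller group whose order has no prime
   divisor below [p]. *)
have inj_coset : {in A &, injective (coset K)}.
  move=> y z Ay Az eq_yz; have := leq_trans (b1_max _ (imset_f _ Ay)) k1_le1.
  by move/card_le1_eqP; apply; rewrite inE ?Ay ?Az ?eq_yz eqxx.
have cardB := card_in_imset inj_coset; rewrite -cardB in leA *.
have leR : (#|restricted_product (coset K @: A)| <= #|restricted_product A|)%N.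
  apply: leq_trans (subset_leq_card (restricted_product_im_coset cGG sKG sAG)) _.
  exact: leq_imset_card.
apply: leq_trans (leq_add leR (leqnn 3)).
apply: (IHm _ (G / K)%G _ _ _ _ (im_coset_sub K sAG)) => //.
- apply: leq_trans (ltn_quotient _ sKG) (ltG : (#|G| <= m)%N).
  by rewrite -cardG_gt1 prime_gt1.
- exact: quotient_abelian.
- by move=> q pr_q dv_q; apply: p_min => //; apply: dvdn_trans dv_q (dvdn_quotient _ _).
Qed.

Lemma erdos_heilbronn_abelian (gT : finGroupType) (G : {group gT}) (p : nat)
    (A : {set gT}) :
    abelian G -> (forall q, prime q -> q %| #|G| -> p <= q)%N -> prime p ->
    A \subset G ->
  (minn p (2 * #|A| - 3) <= #|restricted_product A|)%N.
Proof.
move=> cGG p_min pr_p sAG; have [leA|ltA] := leqP (2 * #|A|) (p + 3).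
  have := restricted_product_abelian cGG p_min sAG leA; lia.
rewrite (minn_idPl _); last by lia.
(* For odd [p], shrinking [A] to (p + 3)/2 elements gives exactly 2|A'| - 3 = p. For p = 2 rounding
   would lose 1, but |A| >= 3, so the products of one element with the others suffice. *)
have [p2|odd_p] := even_prime pr_p.
  have /set0Pn[a Aa] : A != set0 by rewrite -card_gt0; lia.
  have sR : a *: (A :\ a) \subset restricted_product A.
    apply/subsetP=> _ /lcosetP[y + ->]; rewrite !inE => /andP[ya Ay].
    by apply/restricted_productP; exists a, y; rewrite eq_sym ya.
  apply: leq_trans (subset_leq_card sR); rewrite card_lcoset.
  by move: ltA; rewrite p2 (cardsD1 a) Aa; lia.
pose A' := [set x in take ((p + 3) %/ 2) (enum A)].
have cardA' : #|A'| = ((p + 3) %/ 2)%N.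
  rewrite cardsE (card_uniqP (take_uniq _ (enum_uniq _))) size_takel //.
  by rewrite -cardE; lia.
have sA'A : A' \subset A.
  by apply/subsetP=> x; rewrite inE => /mem_take; rewrite mem_enum.
have leA' : (2 * #|A'| <= p + 3)%N by rewrite cardA'; lia.
have := restricted_product_abelian cGG p_min (subset_trans sA'A sAG) leA'.
have := subset_leq_card (restricted_productS sA'A).
by rewrite cardA'; lia.
Qed.

(** * Counting over the cosets met by the set *)

(** Only the cosets [b1 * b] are counted: Erdos-Heilbronn inside [K] for [b = b1], otherwise a
    translate of the fibre over [b1]. Truncated subtraction matches the maximum with 0 in
    [alpha_star]. *)
Lemma restricted_product_cosets (gT : finGroupType) (G K : {group gT})
    (A : {set gT}) (b1 : coset_of K) :
    abelian G -> K \subset G -> A \subset G -> (1 < #|K|)%N ->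
    b1 \in coset K @: A ->
  (minn (pdiv #|K|) (2 * #|fiber K A b1| - 3)
     + #|coset K @: A|.-1 * #|fiber K A b1| <= #|restricted_product A|)%N.
Proof.
move=> cGG sKG sAG K_gt1 Bb1; set B := coset K @: A; set k := #|fiber K A b1|.
have lcosetB : b1 *: B = [set b1 * b | b in B] by rewrite -lcosetE.
have := sum_card_fibers (restricted_product A) (b1 *: B).
rewrite lcosetB big_imset /=; last by move=> b d _ _ /mulgI.
apply: leq_trans; rewrite (big_setD1 b1) //= leq_add //; last first.
  have ->: #|B|.-1 = #|B :\ b1| by rewrite (cardsD1 b1 B) Bb1.
  rewrite -sum_nat_const; apply: leq_sum => b; rewrite in_setD1 => /andP[neq_b Bb].
  have [y yb] := set0Pn _ (fiber_neq0 Bb).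
  rewrite /k -(card_rcoset (fiber K A b1) y); apply/subset_leq_card.
  apply: subset_trans (mul_fiber cGG sKG sAG _); last by rewrite eq_sym.
  by apply: mulgS; rewrite sub1set.
apply: leq_trans (subset_leq_card (restricted_product_fiber cGG sKG sAG b1)).
have [g [A0 [Gg sA0K defA1]]] := fiber_translate cGG sKG sAG Bb1.
rewrite /k defA1 (restricted_product_lcoset cGG) ?(subset_trans sA0K) // card_lcoset.
apply: (erdos_heilbronn_abelian (abelianS sKG cGG)) => //; last exact: pdiv_prime.
by move=> q pr_q dv_q; apply: pdiv_min_dvd (prime_gt1 pr_q) dv_q.
Qed.

Lemma card_lcosets_im_coset (gT : finGroupType) (G H : {group gT}) (A : {set gT}) :
  abelian G -> H \subset G -> A \subset G -> #|lcosets H A| = #|coset H @: A|.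
Proof.
move=> cGG sHG sAG; have nHA := subset_trans sAG (sub_abelian_norm cGG sHG).
rewrite -(card_imset (coset H @: A) val_inj) -imset_comp; congr #|pred_of_set _|.
apply: eq_in_imset => x Ax; rewrite /= val_coset ?(subsetP nHA) // lcosetE.
by rewrite norm_rlcoset ?(subsetP nHA).
Qed.

Lemma setI_lcoset_fiber (gT : finGroupType) (G H : {group gT}) (A : {set gT}) (a : gT) :
    abelian G -> H \subset G -> A \subset G -> a \in G ->
  A :&: a *: H = fiber H A (coset H a).
Proof.
move=> cGG sHG sAG Ga; have nHG := sub_abelian_norm cGG sHG.
have Na := subsetP nHG _ Ga.
apply/setP=> x; rewrite in_setI inE; have [Ax /=|//] := boolP (x \in A).
rewrite -(norm_rlcoset Na); apply: (sameP (rcoset_kercosetP _ Na)); last exact: eqP.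
exact: (subsetP nHG _ (subsetP sAG _ Ax)).
Qed.

End RestrictedProduct.

(** * The bound on the number of cosets in ['Z_n] *)

Theorem theorem7 (n : nat) (hn : (2 <= n)%N)
    (H : {group 'Z_n}) (t : nat) (hHt : #|H| = t) (ht : (3 <= t)%N)
    (A : {set 'Z_n})
    (a : 'Z_n) (C : {set 'Z_n}) (hC : C = (a *: H)%g)
    (x : nat) (hx : x = #|A :&: C|)
    (hmax : forall b : 'Z_n, (#|A :&: (b *: H)%g| <= x)%N)
    (r : int) (hr : r = (num_cosets H A)%:Z - 1)
    (s : nat) (hs : (#|restricted_sumset A| <= t + s)%N) :
  [/\ (0 < x)%N <-> A <> set0,
      (0 < x)%N ->
        r%:Q <= (t%:Z + s%:Z - alpha_star t x)%:Q / x%:Q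
    & 2 * x%:Z - 3 <= (pdiv t)%:Z -> (t + s + 3 < 3 * x)%N ->
        r = 0 /\ A \subset C].
Proof.
have cGG : abelian [set: 'Z_n] by exact: FinRing.zmod_abelian.
have sT (S : {set 'Z_n}) : S \subset [set: 'Z_n] by exact: subsetT.
pose b1 := coset H a.
have defAC : A :&: C = fiber H A b1.
  by rewrite hC (setI_lcoset_fiber cGG) ?inE.
have defr : r = #|coset H @: A|%:Z - 1 by rewrite hr /num_cosets (card_lcosets_im_coset cGG).
have Bb1 : (0 < x)%N -> b1 \in coset H @: A.
  rewrite hx defAC card_gt0 => /set0Pn[y]; rewrite inE => /andP[Ay /eqP <-].
  exact: imset_f.
have r_ge0 : (0 < x)%N -> (0 < #|coset H @: A|)%N.
  by move=> /Bb1 Bb; rewrite card_gt0; apply/set0Pn; exists b1.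
have main : (0 < x)%N -> r * x%:Z + alpha_star t x <= t%:Z + s%:Z.
  move=> x_gt0; have K_gt1 : (1 < #|H|)%N by rewrite hHt ltnW.
  have := restricted_product_cosets cGG (sT H) (sT A) K_gt1 (Bb1 x_gt0).
  rewrite -defAC -hx hHt => le_R; have {}le_R := leq_trans le_R hs.
  rewrite defr /alpha_star; move: (r_ge0 x_gt0) le_R.
  case: #|coset H @: A| => // m _; rewrite [m.+1.-1]/= => le_R.
  have ->: m.+1%:Z - 1 = m%:Z by lia.
  lia.
split.
- split=> [x_gt0 A0|/eqP/set0Pn[b Ab]].
    by move: x_gt0; rewrite hx A0 set0I cards0.
  apply: leq_trans (hmax b); rewrite card_gt0; apply/set0Pn; exists b.
  by rewrite inE Ab lcoset_refl.
- move=> x_gt0; rewrite ler_pdivlMr ?ltr0z // -intrM ler_int.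
  by rewrite lerBrDr; exact: main.
move=> le_p lt_x; have x_gt0 : (0 < x)%N by lia.
(* Here [alpha_star] is at least 2x - 3, so r >= 1 would give 3x <= t + s + 3. *)
have r0 : r = 0.
  have := main x_gt0; have := r_ge0 x_gt0; rewrite /alpha_star defr.
  nia.
split=> //; have cardB : #|coset H @: A| = 1%N by lia.
apply/setIidPl.
rewrite defAC; apply/setP=> y; rewrite inE; case: (boolP (y \in A)) => //= Ay.
have /eqP/cards1P[c defB] := cardB.
have := Bb1 x_gt0; have := imset_f (coset H) Ay.
by rewrite defB !inE => /eqP-> /eqP->; rewrite eqxx.
Qed.
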